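(* Let $m\ge 1$, let $G$ be a dataflow graph, and suppose there are $2^m$ workers. Let $P=\langle p_1,\dots,p_m\rangle$ be any sequence of basic partition plans produced by the recursive partitioning algorithm on $G$. Then $P$ is optimal: for every sequence $O=\langle o_1,\dots,o_m\rangle$ of basic partition plans of $G$, $$\mathrm{cost}(P)\le \mathrm{cost}(O).$$
   Context: Dataflow graph. A dataflow graph $G$ consists of a finite set $\mathcal{T}(G)$ of tensors and a finite set of operators. Each tensor $t$ has a finite number of dimensions, each with an extent (a positive real; halving is always exact, i.e. all partitioning is into equal halves). The size $S_t$ is the product of the extents of $t$, and $t$ is viewed as a box whose regions (sub-boxes) are measured by volume. Each operator has one output tensor, a finite list of input tensors, one output index variable for each dimension of its output tensor, and possibly finitely many further reduction index variables (over which the operator sums, or takes max, min or product). Access pattern assumptions. (1) Each index variable of an operator is used to access at most one dimension of each of its input tensors. (2) Only input dimensions whose access range scales linearly with a single index variable (range of the dimension $=$ constant $\times$ range of that variable) are considered for partitioning. An index variable of an operator is admissible if every input dimension in which it is used is of this form; a tensor dimension is admissible if it is of this form for every operator having the tensor as input. Thus, restricting an admissible index variable $v$ to the first (second) half of its range restricts an input tensor to its first (second) half along the unique dimension accessed by $v$, or requires the whole input tensor if $v$ is not used to access it. Basic partition plan. A basic partition plan $p$ splits the work among two worker groups $0,1$. It chooses (i) for each tensor $t$ one admissible dimension; $t$ is cut into two equal halves along it, and group $g$ stores the $g$-th half; (ii) for each operator one admissible index variable $v$ (output or reduction). Group $g$ then executes the operator with $v$ restricted to the $g$-th half of its range: from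 each input tensor it requires the $g$-th half along the dimension accessed by $v$, or the whole tensor if $v$ does not access it; it produces the $g$-th half of the output tensor along the dimension $v$ if $v$ is an output index variable, and a partial output of the full output shape (to be reduced element-wise with the other group's) if $v$ is a reduction index variable. A plan records only these choices, so the same plan can be applied to a graph with the same tensors and operators but other extents. All graphs considered admit at least one basic partition plan. Cost of a basic plan. The communication cost $\mathrm{cost}(p)$ of $p$ on a graph is the sum, over all operators and both groups, of the sizes of (a) for each input, the part of the required input region that is not stored by the group, and (b) the part of the produced output region that is not stored by the group. Sequences. Applying $p$ to $G$ yields two identical sub-dataflow graphs with the same tensors, operators and access patterns, where the extent of every tensor along its chosen dimension is halved (so every tensor size is halved). In a sequence $\langle p_1,\dots,p_k\rangle$, the plan $p_i$ is applied to all $2^{i-1}$ identical sub-graphs obtained after the first $i-1$ steps. Writing $\mathrm{cost}(p_i)$ for the cost of $p_i$ on one such sub-graph, $$\mathrm{cost}(\langle p_1,\dots,p_k\rangle)=\sum_{i=1}^k 2^{i-1}\,\mathrm{cost}(p_i).$$ A partition plan of $G$ for $2^m$ workers is a sequence of $m$ basic partition plans. Recursive partitioning algorithm. For $i=1,\dots,m$, the algorithm picks a basic partition plan $p_i$ of minimum $\mathrm{cost}(p_i)$ among all basic partition plans on a sub-graph obtained after applying $p_1,\dots,p_{i-1}$ (this exact per-step minimization is done by dynamic programming), and applies the same $p_i$ to all $2^{i-1}$ sub-graphs. *)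

(* Defs.v *)
From mathcomp Require Import all_boot all_order all_algebra.

Set Implicit Arguments.
Unset Strict Implicit.
Unset Printing Implicit Defensive.

Import Order.TTheory GRing.Theory Num.Theory.
Local Open Scope ring_scope.

(* Everything in a dataflow graph except the tensor extents. The index
   variables of an operator o are [inl d], for d a dimension of its output
   tensor, and [inr k], for k < nred o, its reduction variables. *)
Record dataflow_structure (R : realFieldType) := DataflowStructure {
  tensor : finType;
  ndim : tensor -> nat;
  operator : finType;
  out : operator -> tensor;
  nin : operator -> nat;
  inp : forall o : operator, 'I_(nin o) -> tensor;
  nred : operator -> nat;
  (* the index variables used to access dimension d of the i-th input *)
  used : forall (o : operator) (i : 'I_(nin o)),
    'I_(ndim (inp i)) -> {set 'I_(ndim (out o)) + 'I_(nred o)};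
  (* the length of the range accessed along dimension d of the i-th input, as
     a function of the lengths of the ranges of the index variables *)
  access_range : forall (o : operator) (i : 'I_(nin o)),
    'I_(ndim (inp i)) -> ('I_(ndim (out o)) + 'I_(nred o) -> R) -> R;
  access_range_used : forall (o : operator) (i : 'I_(nin o))
      (d : 'I_(ndim (inp i))) (X Y : 'I_(ndim (out o)) + 'I_(nred o) -> R),
    {in used d, X =1 Y} -> access_range d X = access_range d Y;
  (* a variable accesses at most one dimension of each input *)
  used_inj : forall (o : operator) (i : 'I_(nin o)) (d d' : 'I_(ndim (inp i)))
      (v : 'I_(ndim (out o)) + 'I_(nred o)),
    v \in used d -> v \in used d' -> d = d'
}.

Section Plans.

Variables (R : realFieldType) (S : dataflow_structure R).

Implicit Types (t : tensor S) (o : operator S) (g : bool).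

Definition index_var o : finType := ('I_(ndim (out o)) + 'I_(nred o))%type.

Record dataflow_graph := DataflowGraph {
  extent : forall t, 'I_(ndim t) -> R;
  extent_gt0 : forall t (d : 'I_(ndim t)), 0 < extent d
}.

Implicit Type G : dataflow_graph.

Definition linear_access o (i : 'I_(nin o)) (d : 'I_(ndim (inp i))) : Prop :=
  exists v : index_var o, used d = [set v] /\
    exists2 c : R, 0 < c &
      forall X : index_var o -> R, (forall w, 0 < X w) ->
        access_range d X = c * X v.

Definition admissible_var o (v : index_var o) : Prop :=
  forall (i : 'I_(nin o)) (d : 'I_(ndim (inp i))),
    v \in used d -> linear_access d.

(* The [Tagged] equation says that the i-th input of o is t, and that d' is
   the dimension d of t. *)
Definition admissible_dim t (d : 'I_(ndim t)) : Prop :=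
  forall o (i : 'I_(nin o)) (d' : 'I_(ndim (inp i))),
    Tagged (fun u : tensor S => 'I_(ndim u)) d' = Tagged _ d ->
    linear_access d'.

Record basic_plan := BasicPlan {
  tensor_dim : forall t, 'I_(ndim t);
  op_var : forall o, index_var o;
  tensor_dim_admissible : forall t, admissible_dim (tensor_dim t);
  op_var_admissible : forall o, admissible_var (op_var o)
}.

Implicit Type p : basic_plan.

(* A region of t is a box, given by the (lower, upper) bounds of its side along
   each dimension; it is empty as soon as one side has lower > upper. *)
Definition region t := {ffun 'I_(ndim t) -> R * R}.

Definition volume t (A : region t) : R :=
  \prod_d Num.max 0 ((A d).2 - (A d).1).

Definition regionI t (A B : region t) : region t :=
  [ffun d => (Num.max (A d).1 (B d).1, Num.min (A d).2 (B d).2)].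

(* The volume of the set difference A \ B, which need not be a box. *)
Definition volumeD t (A B : region t) : R := volume A - volume (regionI A B).

Definition whole G t : region t := [ffun d => (0, extent G d)].

(* The first (g = false) or second (g = true) half of t along d0. *)
Definition half G g t (d0 : 'I_(ndim t)) : region t :=
  [ffun d => if d == d0 then
               if g then (extent G d / 2, extent G d) else (0, extent G d / 2)
             else (0, extent G d)].

Definition stored G p g t : region t := half G g (tensor_dim p t).

Definition required G p g o (i : 'I_(nin o)) : region (inp i) :=
  if [pick d | op_var p o \in used d] is Some d then half G g d
  else whole G (inp i).

Definition produced G p g o : region (out o) :=
  match op_var p o with
  | inl d => half G g d
  | inr _ => whole G (out o)
  end.

Definition basic_cost G p : R :=
  \sum_(o : operator S) \sum_(g : bool)
    (\sum_(i < nin o) volumeD (required G p g i) (stored G p g (inp i))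
     + volumeD (produced G p g o) (stored G p g (out o))).

Definition halved_extent G p t (d : 'I_(ndim t)) : R :=
  if d == tensor_dim p t then extent G d / 2 else extent G d.

Lemma halved_extent_gt0 G p t (d : 'I_(ndim t)) : 0 < halved_extent G p d.
Proof.
by rewrite /halved_extent; case: ifP => _; rewrite ?divr_gt0 ?extent_gt0.
Qed.

(* Either of the two identical sub-graphs obtained by applying p to G. *)
Definition apply_plan G p : dataflow_graph :=
  DataflowGraph (@halved_extent_gt0 G p).

Definition apply_plans G (ps : seq basic_plan) : dataflow_graph :=
  foldl apply_plan G ps.

(* Steps are numbered from 0: step i acts on 2 ^ i identical sub-graphs. *)
Definition sequence_cost G m (P : m.-tuple basic_plan) : R :=
  \sum_(i < m) 2 ^+ i * basic_cost (apply_plans G (take i P)) (tnth P i).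

(* P is a possible outcome of the recursive algorithm on G (ties between
   basic plans of minimum cost being broken arbitrarily). *)
Definition recursive_partitioning G m (P : m.-tuple basic_plan) : Prop :=
  forall (i : 'I_m) (q : basic_plan),
    basic_cost (apply_plans G (take i P)) (tnth P i)
      <= basic_cost (apply_plans G (take i P)) q.

End Plans.

(* Main.v *)
(* Applying a plan p shrinks every tensor by the factor 1/2 along one dimension.
   All regions entering a basic cost are shrunk along with their tensor, so
   every basic cost is halved, whichever p was applied. This cancels the number
   2 ^ i of sub-graphs: the cost of a sequence is the sum of the costs of its
   plans on G itself, and each step of the recursive algorithm minimizes the
   cost on G. *)
Require Import Defs.
From mathcomp Require Import all_boot all_order all_algebra.

Import Order.TTheory GRing.Theory Num.Theory.
Local Open Scope ring_scope.

Section Scaling.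

Variables (R : realFieldType) (S : dataflow_structure R).

(** Every tensor box has its lower corner at the origin, so halving an extent acts on regions as a
    diagonal linear map, with factor [l d] along [d]. *)
Definition scale_region {t : tensor S} (l : 'I_(ndim t) -> R) (A : region t) :
    region t :=
  [ffun d => (l d * (A d).1, l d * (A d).2)].

Section ScaleRegion.

Variables (t : tensor S) (l : 'I_(ndim t) -> R).
Hypothesis l_ge0 : forall d, 0 <= l d.

(** A nonnegative factor commutes with the truncation at 0, so empty boxes are covered too. *)
Lemma volume_scale (A : region t) :
  volume (scale_region l A) = (\prod_d l d) * volume A.
Proof.
rewrite /volume -big_split /=; apply: eq_bigr => d _.
by rewrite ffunE /= -mulrBr maxr_pMr // mulr0.
Qed.

Lemma regionI_scale (A B : region t) :
  regionI (scale_region l A) (scale_region l B) =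
  scale_region l (regionI A B).
Proof. by apply/ffunP => d; rewrite !ffunE /= maxr_pMr // minr_pMr. Qed.

Lemma volumeD_scale (A B : region t) :
  volumeD (scale_region l A) (scale_region l B) =
  (\prod_d l d) * volumeD A B.
Proof. by rewrite /volumeD regionI_scale !volume_scale mulrBr. Qed.

End ScaleRegion.

Implicit Types (G : dataflow_graph S) (p q : basic_plan S).

Definition shrink p (t : tensor S) (d : 'I_(ndim t)) : R :=
  if d == tensor_dim p t then 2^-1 else 1.
Arguments shrink p {t} d.

Lemma shrink_ge0 p (t : tensor S) (d : 'I_(ndim t)) : 0 <= shrink p d.
Proof. by rewrite /shrink; case: ifP; rewrite ?invr_ge0. Qed.

(** Only the dimension cut by [p] contributes a factor other than 1. *)
Lemma prod_shrink p (t : tensor S) : \prod_(d < ndim t) shrink p d = 2^-1.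
Proof. by rewrite -big_mkcond big_pred1_eq. Qed.

Lemma halved_extentE G p (t : tensor S) (d : 'I_(ndim t)) :
  halved_extent G p d = shrink p d * extent G d.
Proof.
by rewrite /halved_extent /shrink; case: ifP; rewrite ?mul1r // mulrC.
Qed.

Lemma whole_apply_plan G p (t : tensor S) :
  whole (apply_plan G p) t = scale_region (shrink p) (whole G t).
Proof. by apply/ffunP => d; rewrite !ffunE /= mulr0 halved_extentE. Qed.

(** The midpoint scales with the extent, so [d0] may or may not be the dimension that [p] cuts. *)
Lemma half_apply_plan G p g (t : tensor S) (d0 : 'I_(ndim t)) :
  Defs.half (apply_plan G p) g d0 =
  scale_region (shrink p) (Defs.half G g d0).
Proof.
apply/ffunP => d; rewrite !ffunE /= halved_extentE.
by case: ifP => _; case: g; rewrite /= ?mulr0 ?mulrA.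
Qed.

(** The dimension along which the input is restricted depends on [q] and the access pattern, never
    on extents. *)
Lemma required_apply_plan G p q g (o : operator S) (i : 'I_(nin o)) :
  required (apply_plan G p) q g i = scale_region (shrink p) (required G q g i).
Proof.
rewrite /required; case: pickP => [d _|_].
  exact: half_apply_plan.
exact: whole_apply_plan.
Qed.

Lemma produced_apply_plan G p q g (o : operator S) :
  produced (apply_plan G p) q g o = scale_region (shrink p) (produced G q g o).
Proof.
rewrite /produced; case: (op_var q o) => [d|_].
  exact: half_apply_plan.
exact: whole_apply_plan.
Qed.

Lemma basic_cost_apply_plan G p q :
  basic_cost (apply_plan G p) q = 2^-1 * basic_cost G q.
Proof.
(* The factor is the same for all tensors, so it can be pulled out of the whole sum. *)
have shrinkD (t : tensor S) (A B : region t) :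
    volumeD (scale_region (shrink p) A) (scale_region (shrink p) B) =
    2^-1 * volumeD A B.
  by rewrite volumeD_scale ?prod_shrink //; apply: shrink_ge0.
rewrite /basic_cost mulr_sumr; apply: eq_bigr => o _.
rewrite mulr_sumr; apply: eq_bigr => g _.
rewrite mulrDr mulr_sumr produced_apply_plan /stored half_apply_plan shrinkD.
congr (_ + _); apply: eq_bigr => i _.
by rewrite required_apply_plan half_apply_plan shrinkD.
Qed.

Lemma basic_cost_apply_plans G (ps : seq (basic_plan S)) q :
  basic_cost (apply_plans G ps) q = 2 ^- size ps * basic_cost G q.
Proof.
(* The first plan changes the graph, hence the induction is for all [G]. *)
elim: ps G => [|p ps IHps] G /=; first by rewrite invr1 mul1r.
by rewrite IHps basic_cost_apply_plan mulrA exprSr invfM [_^-1 * _]mulrC.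
Qed.

Lemma basic_cost_step G m (P : m.-tuple (basic_plan S)) (i : 'I_m) q :
  basic_cost (apply_plans G (take i P)) q = 2 ^- i * basic_cost G q.
Proof. by rewrite basic_cost_apply_plans size_takel // size_tuple ltnW. Qed.

Lemma sequence_costE G m (P : m.-tuple (basic_plan S)) :
  sequence_cost G P = \sum_(i < m) basic_cost G (tnth P i).
Proof.
apply: eq_bigr => i _.
by rewrite basic_cost_step mulrA divff ?mul1r // expf_neq0 ?pnatr_eq0.
Qed.

End Scaling.

Theorem theorem3 (R : realFieldType) (S : dataflow_structure R)
    (G : dataflow_graph S) (m : nat) (hm : (1 <= m)%N)
    (hplan : inhabited (basic_plan S)) (P : m.-tuple (basic_plan S))
    (hP : recursive_partitioning G P) (O : m.-tuple (basic_plan S)) :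
  sequence_cost G P <= sequence_cost G O.
Proof.
rewrite !sequence_costE; apply: ler_sum => i _.
(* The plan of [O] is tested on the sub-graph reached by [P]; both sides carry the same positive
   factor [2 ^- i], so the comparison passes to [G]. *)
have := hP i (tnth O i).
by rewrite !basic_cost_step ler_pM2l // invr_gt0 exprn_gt0.
Qed.
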